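(* Let $L$ be a positive integer and let $\mathcal S=\{\omega_1,\dots,\omega_s\}\subset[0,1)$ be a set of $s\ge 2$ distinct frequencies satisfying the gap condition $$q=\min_{j\neq l}d(\omega_j,\omega_l)>\frac1L\sqrt{\frac2\pi}\Big(\frac2\pi-\frac4L\Big)^{-\frac12}$$ (where it is understood that $\frac2\pi-\frac4L>0$). (i) If $L$ is even, then for all $c\in\mathbb C^s$, $$\Big(\frac2\pi-\frac{2}{\pi L^2q^2}-\frac4L\Big)\|c\|_2^2\le\frac1L\|\Phi^Lc\|_2^2\le\Big(\frac{4\sqrt2}{\pi}+\frac{\sqrt2}{\pi L^2q^2}+\frac{3\sqrt2}{L}\Big)\|c\|_2^2 .$$ In other words, $$\frac1L\sigma_{\max}^2(\Phi^L)\le\frac{4\sqrt2}{\pi}+\frac{\sqrt2}{\pi L^2q^2}+\frac{3\sqrt2}{L}\qquad\text{and}\qquad \frac1L\sigma_{\min}^2(\Phi^L)\ge\frac2\pi-\frac{2}{\pi L^2q^2}-\frac4L .$$ (ii) If $L$ is odd, then for all $c\in\mathbb C^s$, $$\Big(\frac2\pi-\frac{2}{\pi L^2q^2}-\frac4L\Big)\|c\|_2^2\le\frac1L\|\Phi^Lc\|_2^2\le\Big(1+\frac1L\Big)\Big(\frac{4\sqrt2}{\pi}+\frac{\sqrt2}{\pi(L+1)^2q^2}+\frac{3\sqrt2}{L+1}\Big)\|c\|_2^2 .$$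
   Context: $d(\omega,\omega')=\min_{n\in\mathbb Z}|\omega+n-\omega'|$ is the metric of the torus $[0,1)$. $\Phi^L\in\mathbb C^{(L+1)\times s}$ is the Vandermonde matrix with entries $\Phi^L_{kj}=e^{-2\pi ik\omega_j}$, $k=0,\dots,L$, $j=1,\dots,s$. $\sigma_{\max}(A)$ and $\sigma_{\min}(A)$ denote the largest and the smallest nonzero singular values of a matrix $A$. *)

(* Defs.v *)
From HB Require Import structures.
From mathcomp Require Import all_boot all_order all_algebra.
From mathcomp Require Import complex.
From mathcomp Require Import all_classical all_reals all_analysis.
From mathcomp Require Import lra.

Set Implicit Arguments.
Unset Strict Implicit.
Unset Printing Implicit Defensive.

Import Order.TTheory GRing.Theory Num.Theory.

Local Open Scope classical_set_scope.
Local Open Scope ring_scope.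
Local Open Scope complex_scope.

(* The infimum is a minimum: see torus_distP. *)
Definition torus_dist (R : realType) (w w' : R) : R :=
  inf [set `|w + n%:~R - w'| | n in [set: int]].

(* The infimum is a minimum as soon as there are two indices: see min_gapP. *)
Definition min_gap (R : realType) (s : nat) (w : 'I_s -> R) : R :=
  inf [set torus_dist (w p.1) (w p.2) | p in [set p : 'I_s * 'I_s | p.1 != p.2]].

(* exp(i t) by Euler's formula *)
Definition expi (R : realType) (t : R) : R[i] := cos t +i* sin t.

Definition vandermonde (R : realType) (L s : nat) (w : 'I_s -> R) :
    'M[R[i]]_(L.+1, s) :=
  \matrix_(k < L.+1, j < s) expi (- (2 * pi * k%:R * w j)).

Definition l2norm (R : realType) (n : nat) (v : 'cV[R[i]]_n) : R :=
  Num.sqrt (\sum_(i < n) Normc.normc (v i 0) ^+ 2).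

(* Square roots of the eigenvalues of A^* A. This set may contain 0. *)
Definition singular_values (R : realType) (m n : nat) (A : 'M[R[i]]_(m, n)) :
    set R :=
  [set x | 0 <= x /\ eigenvalue (A^t*%sesqui *m A) (x ^+ 2)%:C].

(* For A != 0 both extrema below are attained at nonzero singular values: see
   sigma_maxP and sigma_minP. *)
Definition sigma_max (R : realType) (m n : nat) (A : 'M[R[i]]_(m, n)) : R :=
  sup (singular_values A `\ 0).

Definition sigma_min (R : realType) (m n : nat) (A : 'M[R[i]]_(m, n)) : R :=
  inf (singular_values A `\ 0).

Lemma inf_min (R : realType) (A : set R) (x : R) :
  A x -> lbound A x -> inf A = x.
Proof.
move=> Ax lAx; apply/eqP; rewrite eq_le; apply/andP; split.
  by apply: ge_inf => //; exists x.
by apply: lb_le_inf => //; exists x.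
Qed.

Lemma sup_max (R : realType) (A : set R) (x : R) :
  A x -> ubound A x -> sup A = x.
Proof.
move=> Ax uAx; apply/eqP; rewrite eq_le; apply/andP; split.
  by apply: ge_sup => //; exists x.
by apply: ub_le_sup => //; exists x.
Qed.

Lemma finite_minimum (R : realType) (A : set R) :
  finite_set A -> A !=set0 -> exists2 x, A x & lbound A x.
Proof.
move=> /finite_seqP[r ->] {A}; elim: r => [[] //|a r IHr _].
case: r IHr => [_|b r IHr].
  by exists a => [|y] /=; rewrite inE // => /eqP->.
have [|x xr xmin] := IHr; first by exists b => /=; rewrite inE eqxx.
have [ax|/ltW xa] := leP a x.
  exists a => [|y] /=; first by rewrite inE eqxx.
  by rewrite inE => /orP[/eqP-> //|yr]; apply: le_trans ax _; apply: xmin.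
exists x => [|y] /=; first by rewrite inE; apply/orP; right.
by rewrite inE => /orP[/eqP-> //|yr]; apply: xmin.
Qed.

Lemma finite_inf (R : realType) (A : set R) :
  finite_set A -> A !=set0 -> A (inf A) /\ lbound A (inf A).
Proof. by move=> fA A0; have [x Ax lAx] := finite_minimum fA A0; rewrite (inf_min Ax). Qed.

Lemma finite_sup (R : realType) (A : set R) :
  finite_set A -> A !=set0 -> A (sup A) /\ ubound A (sup A).
Proof.
move=> fA A0.
have [||_ [x Ax <-] lx] := @finite_minimum R (-%R @` A).
- exact: finite_image.
- by case: A0 => x Ax; exists (- x), x.
have uAx : ubound A x by move=> y Ay; rewrite -lerN2; apply: lx; exists y.
by rewrite (sup_max Ax).
Qed.

Lemma torus_distP (R : realType) (w w' : R) :
  exists2 n : int, torus_dist w w' = `|w + n%:~R - w'|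
    & forall m : int, torus_dist w w' <= `|w + m%:~R - w'|.
Proof.
set f := fun n : int => `|w + n%:~R - w'|.
pose k := Num.floor (w' - w).
have [] := @finite_inf R [set` [:: f k; f (k + 1)]].
- exact: finite_seq.
- by exists (f k) => /=; rewrite inE eqxx.
set m := inf _ => fm lm.
have lbm : lbound [set f n | n in [set: int]] m.
  move=> _ [n _ <-]; have /andP[kl ku] := floor_itv (w' - w).
  have [nk|kn] := leP n k.
    apply: le_trans (lm (f k) _) _; first by rewrite /= inE eqxx.
    have : n%:~R <= k%:~R :> R by rewrite ler_int.
    by rewrite -/k in kl *; rewrite /f => nkR; rewrite !ler0_norm; lra.
  apply: le_trans (lm (f (k + 1)) _) _; first by rewrite /= !inE eqxx orbT.
  have : (k + 1)%:~R <= n%:~R :> R by rewrite ler_int lezD1.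
  by rewrite -/k in ku *; rewrite /f => nkR; rewrite !ger0_norm; lra.
have [n fn] : exists n, f n = m.
  by move: fm => /=; rewrite !inE => /orP[]/eqP->; [exists k|exists (k + 1)].
have -> : torus_dist w w' = m by apply: inf_min => //; exists n.
by exists n => // j; apply: lbm; exists j.
Qed.

Lemma min_gapP (R : realType) (s : nat) (w : 'I_s -> R) : (2 <= s)%N ->
  (exists j l : 'I_s, j != l /\ min_gap w = torus_dist (w j) (w l)) /\
  (forall j l : 'I_s, j != l -> min_gap w <= torus_dist (w j) (w l)).
Proof.
move=> s2; pose j0 : 'I_s := Ordinal (ltnW s2); pose j1 : 'I_s := Ordinal s2.
have [||[[j l] /= jl e] lb] := @finite_inf R
  [set torus_dist (w p.1) (w p.2) | p in [set p : 'I_s * 'I_s | p.1 != p.2]].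
- by apply: finite_image.
- by exists (torus_dist (w j0) (w j1)), (j0, j1).
split; first by exists j, l; split.
by move=> j' l' jl'; apply: lb; exists (j', l').
Qed.

Lemma singular_values_finite (R : realType) (m n : nat) (A : 'M[R[i]]_(m, n)) :
  finite_set (singular_values A).
Proof.
set B := A^t*%sesqui *m A.
have p0 : char_poly B != 0 by rewrite monic_neq0 // char_poly_monic.
have [r Hr] := closed_field_poly_normal (char_poly B).
apply: (@sub_finite_set _ _ [set` [seq Num.sqrt (complex.Re z) | z <- r]]);
  last exact: finite_seq.
move=> x [x0]; rewrite -/B eigenvalue_root_char Hr rootZ ?lead_coef_eq0 //.
rewrite root_prod_XsubC => xr; apply/mapP; exists (x ^+ 2)%:C => //=.
by rewrite sqrtr_sqr ger0_norm.
Qed.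

Lemma singular_values_neq0 (R : realType) (m n : nat) (A : 'M[R[i]]_(m, n)) :
  A != 0 -> singular_values A `\ 0 !=set0.
Proof.
move=> A0; set B := A^t*%sesqui *m A.
have Bherm : B \is hermsymmx.
  apply/is_hermitianmxP; rewrite expr0 scale1r /B.
  by rewrite trmx_mul map_mxM /= trmxCK.
have /orthomx_spectralP := hermitian_normalmx Bherm.
set P := spectralmx B; set d := spectral_diag B => Bd.
have Punit : P \in unitmx by apply: spectral_unit.
have form (v : 'rV_n) : (v *m B *m v^t*%sesqui) 0 0 =
    \sum_i `|(v *m A^t*%sesqui) 0 i| ^+ 2.
  have -> : v *m B *m v^t*%sesqui =
      (v *m A^t*%sesqui) *m (v *m A^t*%sesqui)^t*%sesqui.
    by rewrite trmx_mul map_mxM /= trmxCK !mulmxA.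
  by rewrite mxE; apply: eq_bigr => i _; rewrite !mxE normCK.
have [d0|] := eqVneq d 0.
  case/negP: A0; have B0 : B = 0 by rewrite Bd d0 raddf0 mulmx0 mul0mx.
  have A0 (v : 'rV_n) : v *m A^t*%sesqui = 0.
    have := form v; rewrite B0 mulmx0 mul0mx mxE => /esym/eqP.
    rewrite psumr_eq0 => [/allP h|i _]; last exact: exprn_ge0.
    apply/rowP => i; rewrite [RHS]mxE; apply/eqP.
    by have := h i (mem_index_enum _); rewrite /= sqrf_eq0 normr_eq0.
  have AC0 : A^t*%sesqui = 0 by apply/row_matrixP => i; rewrite rowE A0 row0.
  by rewrite -(trmxCK A) AC0 trmx0 map_mx0.
case/rV0Pn => i di0.
have vB : row i P *m B = d 0 i *: row i P.
  rewrite -row_mul Bd !mulmxA mulmxV // mul1mx mul_diag_mx.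
  by apply/rowP => j; rewrite !mxE.
have rP0 : row i P != 0.
  apply: contraTneq Punit => r0; rewrite -row_free_unit -kermx_eq0.
  apply/rowV0Pn; exists (delta_mx 0 i); last first.
    by apply/negP => /eqP/matrixP/(_ 0 i)/eqP; rewrite !mxE !eqxx oner_eq0.
  by apply/sub_kermxP; rewrite -rowE.
have eB : eigenvalue B (d 0 i) by apply/eigenvalueP; exists (row i P).
have dge0 : 0 <= d 0 i.
  have Pu : row i P *m (row i P)^t*%sesqui = 1%:M.
    have /row_unitarymxP/(_ i i) := spectral_unitarymx B.
    rewrite dotmxE eqxx => h; apply/matrixP => a b.
    by rewrite !ord1 h mxE eqxx.
  have <- : (row i P *m B *m (row i P)^t*%sesqui) 0 0 = d 0 i.
    by rewrite vB -scalemxAl Pu !mxE eqxx mulr1.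
  by rewrite form sumr_ge0 // => j _; apply: exprn_ge0.
have dE : d 0 i = (complex.Re (d 0 i))%:C.
  by apply/eqP; rewrite eq_sym; apply/eqP/RRe_real/ger0_real.
have Re0 : 0 <= complex.Re (d 0 i) by rewrite dE lecR in dge0.
have Ren0 : Num.sqrt (complex.Re (d 0 i)) <> 0.
  move/eqP; rewrite sqrtr_eq0 => Rele0.
  have Re00 : complex.Re (d 0 i) = 0 by apply/eqP; rewrite eq_le Rele0 Re0.
  by move/eqP: di0; apply; rewrite dE Re00.
have eB' : eigenvalue B (Num.sqrt (complex.Re (d 0 i)) ^+ 2)%:C.
  by rewrite (sqr_sqrtr Re0) -dE; exact: eB.
exists (Num.sqrt (complex.Re (d 0 i))).
exact: (conj (conj (sqrtr_ge0 _) eB') Ren0).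
Qed.

Lemma sigma_maxP (R : realType) (m n : nat) (A : 'M[R[i]]_(m, n)) : A != 0 ->
  (singular_values A `\ 0) (sigma_max A) /\
  ubound (singular_values A) (sigma_max A).
Proof.
move=> A0; have [||smax umax] := @finite_sup _ (singular_values A `\ 0).
- exact/finite_setD/singular_values_finite.
- exact: singular_values_neq0.
split=> // x xs; have [->|x0] := eqVneq x 0; first by case: smax => -[].
by apply: umax; split => //; apply/eqP.
Qed.

Lemma sigma_minP (R : realType) (m n : nat) (A : 'M[R[i]]_(m, n)) : A != 0 ->
  (singular_values A `\ 0) (sigma_min A) /\
  lbound (singular_values A `\ 0) (sigma_min A).
Proof.
move=> A0; apply: finite_inf; last exact: singular_values_neq0.
exact/finite_setD/singular_values_finite.
Qed.

(* Main.v *)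
Require Import Defs.
From mathcomp Require Import all_boot all_order all_algebra.
From mathcomp Require Import complex.
From mathcomp Require Import all_classical all_reals all_analysis.
From mathcomp Require Import ring lra.
Import Order.TTheory GRing.Theory Num.Theory.
Import numFieldNormedType.Exports.
Local Open Scope ring_scope.

(* A discrete Ingham inequality. Weight the samples |f(k)|^2 of the exponential
   sum f with the half-period sine window sin(pi k / N), k < N. The resulting
   quadratic form has Toeplitz coefficients
     sin(pi/N) cos(pi N x) / (cos(2 pi x) - cos(pi/N)),  x = w_j - w_l,
   whose diagonal value is about 2N/pi and whose off-diagonal part is bounded by
   (2N/pi) / (4 N^2 d^2 - 1) up to an O(1/N) error, d being the torus distance.
   By the separation, the off-diagonal row sums are at most
   (2N/pi) / (N q)^2 up to O(1), because sum_m 1/(4 m^2 - 1) = 1/2. The lower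
   frame bound takes N = L and uses that the weights are at most 1. The upper one
   takes N = 2L and centers the samples in the window, where the weights are at
   least 1/sqrt 2. For L odd the upper bound at L + 1 is used. *)

(** * Taylor bounds for sine and cosine, and a bound on [pi] *)

Lemma le_of_derive_ge0 {R : realType} (f df : R -> R) (x : R) :
  (forall y : R, is_derive y (1 : R) f (df y)) -> (forall y : R, 0 <= y -> 0 <= df y) ->
  0 <= x -> f 0 <= f x.
Proof.
move=> fdf df0 x0; rewrite -subr_ge0.
have cf : {within `[0, x], continuous f}%classic.
  apply: continuous_subspaceT => y.
  exact/differentiable_continuous/derivable1_diffP/ex_derive.
have [c /[!in_itv]/= /andP[c0 _] ->] := MVT_segment x0 (fun y _ => fdf y) cf.
by rewrite subr0 mulr_ge0 // df0.
Qed.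

Lemma sin_le {R : realType} (x : R) : 0 <= x -> sin x <= x.
Proof.
move=> x0; pose df (y : R) := 1 - cos y.
have : (0 - sin 0 : R) <= x - sin x.
  apply: (@le_of_derive_ge0 _ (fun y => y - sin y) df) => // y _.
  by rewrite subr_ge0 cos_le1.
by rewrite sin0; lra.
Qed.

Lemma cos_sin_half {R : realType} (x : R) : cos x = 1 - 2 * sin (x / 2) ^+ 2.
Proof.
rewrite {1}(_ : x = x / 2 *+ 2); last by rewrite -mulr_natr divfK.
by rewrite cos_mulr2n cos2sin2 -mulr_natr; ring.
Qed.

(** The half-angle formula reduces this to [|sin (x / 2)| <= x / 2]. *)
Lemma cos_ge {R : realType} (x : R) : 0 <= x -> 1 - x ^+ 2 / 2 <= cos x.
Proof.
move=> x0; rewrite cos_sin_half.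
have : `|sin (x / 2)| <= x / 2.
  rewrite ler_norml sin_le ?divr_ge0 // andbT.
  have [x2|x2] := lerP x 2; last by have := sin_geN1 (x / 2); lra.
  suff : 0 <= sin (x / 2) by lra.
  by apply: sin_ge0_pi; have := @pi_ge2 R; lra.
rewrite -ler_sqr ?nnegrE //; last lra.
by rewrite real_normK ?num_real // => h; nra.
Qed.

(** The difference of the two sides vanishes at 0, and its derivative is nonnegative by [cos_ge]. *)
Lemma sin_ge {R : realType} (x : R) : 0 <= x -> x - x ^+ 3 / 6 <= sin x.
Proof.
move=> x0; pose df (y : R) := cos y - (1 - y ^+ 2 / 2).
have : sin 0 - (0 - 0 ^+ 3 / 6 : R) <= sin x - (x - x ^+ 3 / 6).
  apply: (@le_of_derive_ge0 _ (fun y => sin y - (y - y ^+ 3 / 6)) df) => //.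
    move=> y; apply: is_derive_eq; rewrite /df.
    by rewrite !scaler0 add0r /GRing.scale /=; field.
  by move=> y y0; rewrite subr_ge0 cos_ge.
by rewrite sin0 expr0n /=; lra.
Qed.

(* [cos (8/5) = 1 - 2 sin (4/5)^2 < 0]. *)
Lemma pi_le_3dot2 {R : realType} : (pi : R) <= 16 / 5.
Proof.
rewrite leNgt; apply/negP => pi_gt.
have : 0 < cos (8 / 5 : R) by apply: cos_gt0_pihalf; lra.
rewrite cos_sin_half; have : (8 / 5 / 2 : R) - (8 / 5 / 2) ^+ 3 / 6 <= sin (8 / 5 / 2).
  by apply: sin_ge; lra.
by move: (sin _) => s h; nra.
Qed.

(* From [sin t >= t - t^3/6] on both factors; [a <= 1/4] and [y <= 8/5 ~ pi/2]
   leave enough room for the constant 2. *)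
Lemma sin_mul_ge {R : realType} (a y : R) : 0 < a -> a <= 1 / 4 ->
  2 * a <= y -> y <= 8 / 5 ->
  0 < sin (y + a) * sin (y - a) /\
  (sin (y + a) * sin (y - a))^-1 <= (y ^+ 2 - a ^+ 2)^-1 + 2.
Proof.
move=> a0 a4 ay y1.
have su : (y + a) * (1 - (y + a) ^+ 2 / 6) <= sin (y + a).
  have /sin_ge : 0 <= y + a by lra.
  by apply: le_trans; rewrite le_eqVlt; apply/orP; left; apply/eqP; field.
have sv : (y - a) * (1 - (y - a) ^+ 2 / 6) <= sin (y - a).
  have /sin_ge : 0 <= y - a by lra.
  by apply: le_trans; rewrite le_eqVlt; apply/orP; left; apply/eqP; field.
have u6 : 0 < 1 - (y + a) ^+ 2 / 6 by nra.
have v6 : 0 < 1 - (y - a) ^+ 2 / 6 by nra.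
pose T := y ^+ 2 - a ^+ 2.
have T0 : 0 < T by rewrite /T; nra.
pose P := (1 - (y + a) ^+ 2 / 6) * (1 - (y - a) ^+ 2 / 6).
have P0 : 0 < P by exact: mulr_gt0.
have TP : T * P <= sin (y + a) * sin (y - a).
  have -> : T * P = ((y + a) * (1 - (y + a) ^+ 2 / 6)) *
                    ((y - a) * (1 - (y - a) ^+ 2 / 6)) by rewrite /T /P; ring.
  by apply: ler_pM => //; apply: mulr_ge0 => //; lra.
split; first exact: lt_le_trans (mulr_gt0 T0 P0) TP.
apply: (@le_trans _ _ (T * P)^-1).
  have TP0 := mulr_gt0 T0 P0.
  by rewrite lef_pV2 // posrE // (lt_le_trans TP0 TP).
rewrite -/T -subr_ge0.
have -> : T^-1 + 2 - (T * P)^-1 = (P + 2 * T * P - 1) / (T * P).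
  by field; rewrite !gt_eqF.
apply: divr_ge0; last exact/ltW/mulr_gt0.
have PE : P = 1 - (y ^+ 2 + a ^+ 2) / 3 + T ^+ 2 / 36 by rewrite /P /T; field.
have A0 : 0 <= a ^+ 2 by exact: sqr_ge0.
have A1 : a ^+ 2 <= 1 / 16 by nra.
have A2 : 4 * a ^+ 2 <= y ^+ 2 by nra.
have Y1 : y ^+ 2 <= 64 / 25 by nra.
move: PE A0 A1 A2 Y1; rewrite /T; move: (a ^+ 2) (y ^+ 2) => A Y PE A0 A1 A2 Y1.
have P28 : 7 / 25 <= P.
  (* The square in [P] is replaced by its tangent at [Y - A = 5 / 2], close to the largest possible
     value 64/25. *)
  by have := sqr_ge0 (Y - A - 5 / 2); rewrite PE; nra.
(* This just suffices: [2 (Y - A) P >= 21/50 Y], while [1 - P <= (Y + A) / 3 <= 5/12 Y] because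
   [A <= Y / 4]. *)
have : (3 / 4 * Y) * (7 / 25) <= (Y - A) * P by apply: ler_pM; lra.
have := sqr_ge0 (Y - A); rewrite PE; nra.
Qed.

(** * Closed form of the windowed trigonometric sums *)

(* Discrete Wronskian: [sin (al * k)] and [cos (th * k + ph)] solve the
   recurrences [x_(k+1) + x_(k-1) = 2 cos al x_k], resp. [2 cos th x_k], so the
   summand times [2 (cos th - cos al)] telescopes. *)
Lemma window_sum {R : realType} (n : nat) (al th ph : R) :
  (cos th - cos al) * (2 * \sum_(k < n) sin (al * k%:R) * cos (th * k%:R + ph))
  = sin (al * n%:R - al) * cos (th * n%:R + ph)
    - sin (al * n%:R) * cos (th * n%:R + ph - th) + sin al * cos ph.
Proof.
elim: n => [|n IH].
  by rewrite big_ord0 !mulr0 !add0r sin0 sinN; ring.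
rewrite big_ord_recr /= !mulrDr IH.
have -> : al * n.+1%:R - al = al * n%:R by rewrite -natr1; ring.
have -> : th * n.+1%:R + ph - th = th * n%:R + ph by rewrite -natr1; ring.
have -> : th * n.+1%:R + ph = (th * n%:R + ph) + th by rewrite -natr1; ring.
have -> : al * n.+1%:R = al * n%:R + al by rewrite -natr1; ring.
move: (th * n%:R + ph) (al * n%:R) => x z.
rewrite !sinB !cosB sinD cosD; ring.
Qed.

Lemma window_sum_pi {R : realType} (N : nat) (th ph : R) : (0 < N)%N ->
  (cos th - cos (pi / N%:R)) *
    (2 * \sum_(k < N) sin (pi / N%:R * k%:R) * cos (th * k%:R + ph))
  = sin (pi / N%:R) * (cos (th * N%:R + ph) + cos ph).
Proof.
move=> N0; rewrite window_sum divfK ?pnatr_eq0 -?lt0n //.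
by rewrite sinB sinpi cospi; ring.
Qed.

Lemma cosD_2piz {R : realType} (x : R) (n : int) :
  cos (x + 2 * pi * n%:~R) = cos x.
Proof.
have h (y : R) (m : nat) : cos (y + 2 * pi * m%:R) = cos y.
  elim: m => [|m IH]; first by rewrite mulr0 addr0.
  rewrite -[RHS]IH -[RHS]cosD2pi; congr (cos _).
  by rewrite -natr1 -mulr_natr; ring.
case: n => n; first exact: h.
by rewrite NegzE mulrNz mulrN -[LHS](h _ n.+1) -addrA addNr addr0.
Qed.

(** * Sums over separated points of the torus *)

Lemma sum_inj_le {R : realType} (I : finType) (P : pred I) (f : I -> nat)
    (M : nat) (b : nat -> R) :
  (forall m, 0 <= b m) -> {in P &, injective f} ->
  (forall i, P i -> (f i < M)%N) ->
  \sum_(i | P i) b (f i) <= \sum_(m < M) b m.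
Proof.
move=> b0 finj fM; case: M fM => [|M] fM.
  rewrite big_ord0 big_pred0 // => i; apply/negbTE/negP => /fM.
  by rewrite ltn0.
pose h i : 'I_M.+1 := inord (f i).
have hE i : P i -> h i = f i :> nat by move=> /fM /inordK.
have hinj : {in [set i | P i] &, injective h}.
  move=> i i'; rewrite !inE => Pi Pi' e; apply: finj => //.
  by rewrite -hE // e hE.
rewrite (_ : \sum_(i | P i) _ = \sum_(i in [set i | P i]) b (h i)); last first.
  rewrite [RHS](eq_bigl P) => [|i]; last by rewrite inE.
  by apply: eq_bigr => i /hE->.
rewrite -(big_imset (fun m : 'I_M.+1 => b m) hinj) /=.
by rewrite big_mkcond ler_sum // => m _; case: ifP.
Qed.

(** A minimal lift [z] is no longer than its neighbours [z - 1] and [z + 1]. *)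
Lemma torus_dist_le_half {R : realType} (x y : R) : torus_dist x y <= 1 / 2.
Proof.
have [n e h] := torus_distP x y.
have := h (n + 1); have := h (n - 1); rewrite e rmorphB rmorphD /= mulr1z.
set z := x + n%:~R - y.
have -> : x + (n%:~R - 1) - y = z - 1 by rewrite /z; ring.
have -> : x + (n%:~R + 1) - y = z + 1 by rewrite /z; ring.
by case: (ger0P z) => ?; case: (ger0P (z - 1)) => ?;
  case: (ger0P (z + 1)) => ?; lra.
Qed.

(** Lets the separation of two points be tested on lifts chosen near a third point [z]. *)
Lemma torus_dist_le_shift {R : realType} (x y z : R) (m n : int) :
  torus_dist x y <= `|(x + m%:~R - z) - (y + n%:~R - z)|.
Proof.
have [_ _ h] := torus_distP x y; apply: le_trans (h (m - n)) _.
by rewrite rmorphB /= le_eqVlt; apply/orP; left; apply/eqP; congr (`|_|); ring.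
Qed.

(* On each side of [w j], the cells [[m q, (m+1) q)], [m >= 1], contain at most
   one of the other points each. *)
Lemma sum_separated_le {R : realType} (s : nat) (w : 'I_s -> R) (q : R)
    (j : 'I_s) (b : nat -> R) :
  0 < q -> (forall l l' : 'I_s, l != l' -> q <= torus_dist (w l) (w l')) ->
  (forall m, 0 <= b m) ->
  \sum_(l | l != j) b (Num.truncn (torus_dist (w l) (w j) / q)).-1
    <= 2 * \sum_(m < Num.truncn ((2 * q)^-1)) b m.
Proof.
move=> q0 sep b0.
have /choice[n nE] l : exists n : int,
    torus_dist (w l) (w j) = `|w l + n%:~R - w j|.
  by have [n] := torus_distP (w l) (w j); exists n.
(* Signed position, seen from [w j], of the lift of [w l] closest to it; the sign tells the side. *)
pose d l := w l + (n l)%:~R - w j.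
pose f l := (Num.truncn (torus_dist (w l) (w j) / q)).-1.
have d0 l : 0 <= torus_dist (w l) (w j) / q.
  by rewrite nE divr_ge0 // ltW.
have t1 l : l != j -> (0 < Num.truncn (torus_dist (w l) (w j) / q))%N.
  by move=> lj; rewrite truncn_gt0 ler_pdivlMr // mul1r sep.
(* Torus distances are at most 1/2, so at most [1 / (2 q)] cells occur on each side. *)
have fM l : l != j -> (f l < Num.truncn ((2 * q)^-1))%N.
  move=> lj; rewrite /f prednK ?t1 // le_truncn // ler_pdivrMr //.
  by rewrite invfM mulfVK ?gt_eqF // -div1r torus_dist_le_half.
(* Two points on the same side and in the same cell would be less than [q] apart. *)
have finj l l' : l != j -> l' != j -> (0 <= d l) = (0 <= d l') ->
    f l = f l' -> l = l'.
  move=> lj lj' sg /(congr1 S); rewrite /f !prednK ?t1 // => e.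
  apply/eqP/negP => /negP ll'.
  have := le_trans (sep _ _ ll') (torus_dist_le_shift _ _ (w j) (n l) (n l')).
  rewrite -!/(d _) leNgt => /negP; apply.
  have := truncn_itv (d0 l); have := truncn_itv (d0 l'); rewrite e !nE -!/(d _).
  rewrite -natr1 !ler_pdivlMr // !ltr_pdivrMr // mulrDl mul1r.
  case/andP=> a1 a2 /andP[a3 a4]; rewrite ltr_norml; move: sg a1 a2 a3 a4.
  by case: (ger0P (d l)) => h; case: (ger0P (d l')) => h' // _ ? ? ? ?;
    apply/andP; split; lra.
rewrite (bigID (fun l => 0 <= d l)) /= mulrDl mul1r.
by apply: lerD; apply: sum_inj_le
    => // [l l' /andP[lj sl] /andP[lj' sl']|l /andP[/fM//]];
  apply: finj => //; rewrite ?sl ?sl' ?(negbTE sl) ?(negbTE sl').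
Qed.

(** * A telescoping series and the Schur test *)

(** Each term is half of [1 / (2 m + 1) - 1 / (2 m + 3)]. *)
Lemma sum_inv_4sqrB1_le {R : realType} (M : nat) :
  \sum_(m < M) (4 * m.+1%:R ^+ 2 - 1)^-1 <= 1 / 2 :> R.
Proof.
suff -> : \sum_(m < M) (4 * m.+1%:R ^+ 2 - 1)^-1 =
    1 / 2 - (2 * (2 * M%:R + 1))^-1 :> R.
  by rewrite lerBlDr lerDl invr_ge0; have := ler0n R M; lra.
elim: M => [|M IH]; first by rewrite big_ord0; field.
rewrite big_ord_recr /= IH -[M.+1%:R]natr1; have := ler0n R M; move: (M%:R) => x x0.
by field; rewrite !gt_eqF //; nra.
Qed.

(** Off the diagonal, [|x_j x_l| <= (x_j^2 + x_l^2) / 2]; by symmetry of [K] both halves contribute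
    the same row sums. *)
Lemma schur_test {R : realType} (s : nat) (K : 'I_s -> 'I_s -> R) (D S : R)
    (x : 'I_s -> R) :
  (forall j, K j j = D) -> (forall j l, K j l = K l j) ->
  (forall j, \sum_(l | l != j) `|K j l| <= S) ->
  `|\sum_j \sum_l x j * x l * K j l - D * \sum_j x j ^+ 2|
    <= S * \sum_j x j ^+ 2.
Proof.
move=> KD Ksym KS.
have -> : \sum_j \sum_l x j * x l * K j l - D * \sum_j x j ^+ 2 =
    \sum_j \sum_(l | l != j) x j * x l * K j l.
  rewrite mulr_sumr -sumrB; apply: eq_bigr => j _.
  by rewrite (bigD1 j) //= KD; ring.
apply: (@le_trans _ _
    (\sum_j \sum_(l | l != j) (x j ^+ 2 / 2 + x l ^+ 2 / 2) * `|K j l|)).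
  apply: le_trans (ler_norm_sum _ _ _) _; apply: ler_sum => j _.
  apply: le_trans (ler_norm_sum _ _ _) _; apply: ler_sum => l _.
  rewrite normrM ler_wpM2r // normrM.
  rewrite -(real_normK (num_real (x j))) -(real_normK (num_real (x l))).
  by have := sqr_ge0 (`|x j| - `|x l|); lra.
have E : \sum_j \sum_(l | l != j) x l ^+ 2 / 2 * `|K j l| =
    \sum_j \sum_(l | l != j) x j ^+ 2 / 2 * `|K j l|.
  rewrite (exchange_big_dep predT) //=; apply: eq_bigr => l _.
  by apply: eq_big => [j|j _]; rewrite 1?eq_sym // Ksym.
have -> : \sum_j \sum_(l | l != j) (x j ^+ 2 / 2 + x l ^+ 2 / 2) * `|K j l| =
    \sum_j x j ^+ 2 * \sum_(l | l != j) `|K j l|.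
  under eq_bigr => j _ do (under eq_bigr => l _ do rewrite mulrDl);
  under eq_bigr => j _ do rewrite big_split /=.
  rewrite big_split /= E -big_split /=; apply: eq_bigr => j _.
  by rewrite -!mulr_sumr; field.
rewrite mulr_sumr; apply: ler_sum => j _.
by rewrite mulrC ler_wpM2r ?sqr_ge0.
Qed.

(** * The sine kernel and its row sums *)

(** The samples are centered at [N / 2], about which the window is symmetric, so the Toeplitz
    coefficients are real and even in [x]. *)
Definition sine_kernel {R : realType} (N : nat) (x : R) : R :=
  \sum_(k < N) sin (pi / N%:R * k%:R) * cos (2 * pi * (k%:R - N%:R / 2) * x).

(** The phase [- pi N x] in [window_sum_pi] centers the samples and makes the two boundary cosines
    equal. *)
Lemma sine_kernelE {R : realType} (N : nat) (x : R) : (0 < N)%N ->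
  (cos (2 * pi * x) - cos (pi / N%:R)) * sine_kernel N x
  = sin (pi / N%:R) * cos (pi * N%:R * x).
Proof.
move=> N0; have := @window_sum_pi R N (2 * pi * x) (- (pi * N%:R * x)) N0.
have -> : 2 * pi * x * N%:R + - (pi * N%:R * x) = pi * N%:R * x by ring.
rewrite cosN => h; apply: (@mulfI _ 2) => //.
rewrite [RHS](_ : _ = sin (pi / N%:R) * (cos (pi * N%:R * x) + cos (pi * N%:R * x)));
  last by ring.
rewrite -h mulrCA; congr (_ * (_ * _)); apply: eq_bigr => k _.
by congr (_ * cos _); field.
Qed.

(** A further phase of [- pi / 2] turns the cosines into sines, and the two boundary terms, now odd,
    cancel. *)
Lemma sine_window_sin_eq0 {R : realType} (N : nat) (x : R) : (0 < N)%N ->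
  cos (2 * pi * x) != cos (pi / N%:R) ->
  \sum_(k < N) sin (pi / N%:R * k%:R) * sin (2 * pi * (k%:R - N%:R / 2) * x) = 0.
Proof.
move=> N0 ne.
have := @window_sum_pi R N (2 * pi * x) (- (pi * N%:R * x) - pi / 2) N0.
rewrite addrA cosBpihalf cosBpihalf.
have -> : 2 * pi * x * N%:R + - (pi * N%:R * x) = pi * N%:R * x by ring.
rewrite sinN subrr mulr0 => /eqP.
rewrite !mulf_eq0 subr_eq0 (negbTE ne) pnatr_eq0 /= => /eqP h.
rewrite -[RHS]h; apply: eq_bigr => k _; rewrite addrA cosBpihalf.
by congr (_ * sin _); field.
Qed.

(** With [a = pi / (2 N)] the kernel at 0 is [cot a] and the main term is [1 / a]; the claim is
    [|cot a - 1 / a| <= a / 2]. *)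
Lemma sine_kernel0 {R : realType} (N : nat) : 2 * pi <= N%:R :> R ->
  `|sine_kernel N 0 - 2 * N%:R / pi| <= pi / (2 * N%:R) / 2 :> R.
Proof.
move=> pN; pose a : R := pi / (2 * N%:R).
have p0 := @pi_gt0 R.
have n0 : 0 < N%:R :> R by lra.
have N0 : (0 < N)%N by rewrite ltr0n in n0.
have a0 : 0 < a by rewrite divr_gt0 ?mulr_gt0.
have a1 : a <= 1 / 4 by rewrite /a ler_pdivrMr ?mulr_gt0 //; lra.
have aE : pi / N%:R = a + a by rewrite /a; field; rewrite gt_eqF.
have /sin_ge s0 := ltW a0; have /cos_ge c0 := ltW a0.
have sp : 0 < sin a by nra.
have kE : sine_kernel N (0 : R) = cos a / sin a.
  have := @sine_kernelE R N 0 N0; rewrite !mulr0 cos0 mulr1 aE.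
  (* The factor [2 sin(a)^2] is [1 - cos (2 a)], the factor of the kernel in its closed form. *)
  rewrite sinD cosD => h; apply: (@mulfI _ (sin a * sin a * 2)).
    by rewrite gt_eqF // !mulr_gt0.
  transitivity (sin a * cos a + cos a * sin a); last by field; rewrite gt_eqF.
  rewrite -h -!expr2 cos2sin2; ring.
have -> : 2 * N%:R / pi = a^-1 by rewrite /a invf_div.
rewrite kE -/a ler_norml; apply/andP; split.
- rewrite lerBrDr ler_pdivlMr //.
  have s1 := sin_le _ (ltW a0).
  (* As [(1 / a - a / 2) a = 1 - a^2 / 2], the gap to the lower bound for the cosine is
     [(1 / a - a / 2) (a - sin a)]. *)
  apply: le_trans c0; rewrite -subr_ge0.
  have h : 0 <= - (a / 2) + a^-1.
    have : 4 <= a^-1 by rewrite -[4]invrK lef_pV2 ?posrE //; lra.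
    by lra.
  apply: (@le_trans _ _ ((- (a / 2) + a^-1) * (a - sin a))).
    by rewrite mulr_ge0 // subr_ge0.
  by rewrite le_eqVlt; apply/orP; left; apply/eqP; field; rewrite gt_eqF.
- rewrite lerBlDr ler_pdivrMr //; apply: le_trans (cos_le1 _) _.
  have : (a / 2 + a^-1) * (a - a ^+ 3 / 6) <= (a / 2 + a^-1) * sin a.
    by rewrite ler_wpM2l // addr_ge0 // ?invr_ge0 ?divr_ge0 // ltW.
  apply: le_trans.
  have -> : (a / 2 + a^-1) * (a - a ^+ 3 / 6) = 1 + a ^+ 2 / 3 - a ^+ 2 * a ^+ 2 / 12.
    by field; rewrite gt_eqF.
  have : 0 <= a ^+ 2 by exact: sqr_ge0.
  have : a ^+ 2 <= 4 by nra.
  by move: (a ^+ 2) => A ? ?; nra.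
Qed.

(** With [y = pi |d|], the divisor in [sine_kernelE] is [- 2 sin (y + a) sin (y - a)], controlled by
    [sin_mul_ge], and the numerator is at most [2 a]. The first conclusion supplies the hypothesis
    of [sine_window_sin_eq0]. *)
Lemma sine_kernel_le {R : realType} (N : nat) (x d : R) (n : int) :
  2 * pi <= N%:R :> R -> `|d| <= 1 / 2 -> 1 <= N%:R * `|d| -> x = d + n%:~R ->
  let a : R := pi / (2 * N%:R) in
  cos (2 * pi * x) != cos (pi / N%:R) /\
  `|sine_kernel N x| <= a * (((pi * `|d|) ^+ 2 - a ^+ 2)^-1 + 2).
Proof.
move=> pN d2 Nd xE a.
have p0 := @pi_gt0 R; have p3 := @pi_le_3dot2 R.
have n0 : 0 < N%:R :> R by lra.
have N0 : (0 < N)%N by rewrite ltr0n in n0.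
have a0 : 0 < a by rewrite divr_gt0 ?mulr_gt0.
have a1 : a <= 1 / 4 by rewrite /a ler_pdivrMr ?mulr_gt0 //; lra.
have aE : pi / N%:R = a + a by rewrite /a; field; rewrite gt_eqF.
pose y := pi * `|d|.
have ay : 2 * a <= y.
  by rewrite mulr2n mulrDl !mul1r -aE ler_pdivrMr // /y; nra.
(* Here [pi <= 16 / 5] meets [|d| <= 1 / 2]. *)
have y1 : y <= 8 / 5 by rewrite /y; nra.
have cE : cos (2 * pi * x) = cos (y + y).
  rewrite xE mulrDr cosD_2piz /y -[LHS]cos_norm normrM gtr0_norm ?mulr_gt0 //.
  by congr cos; ring.
have [ss ssV] := sin_mul_ge _ _ a0 a1 ay y1.
have dE : cos (2 * pi * x) - cos (pi / N%:R) = - (2 * (sin (y + a) * sin (y - a))).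
  rewrite cE aE !cosD sinD sinB.
  have := cos2Dsin2 y; have := cos2Dsin2 a.
  move: (cos y) (sin y) (cos a) (sin a) => c s c' s' h h'.
  have -> : c * c = 1 - s ^+ 2 by rewrite -h'; ring.
  have -> : c' * c' = 1 - s' ^+ 2 by rewrite -h; ring.
  have -> : (s * c' + c * s') * (s * c' - c * s') = s ^+ 2 * c' ^+ 2 - c ^+ 2 * s' ^+ 2.
    by ring.
  have -> : c ^+ 2 = 1 - s ^+ 2 by rewrite -h'; ring.
  have -> : c' ^+ 2 = 1 - s' ^+ 2 by rewrite -h; ring.
  by ring.
split; first by rewrite -subr_eq0 dE oppr_eq0 gt_eqF // mulr_gt0.
have h : 2 * (sin (y + a) * sin (y - a)) * `|sine_kernel N x|
    = `|sin (pi / N%:R)| * `|cos (pi * N%:R * x)|.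
  rewrite -normrM -sine_kernelE // dE normrM normrN; congr (_ * _).
  by rewrite gtr0_norm // mulr_gt0.
have s2a : `|sin (pi / N%:R)| <= 2 * a.
  rewrite aE ger0_norm; first by apply: le_trans (sin_le _ _) _; lra.
  by apply: sin_ge0_pi; have := @pi_ge2 R; lra.
have h2 : 2 * (sin (y + a) * sin (y - a)) * `|sine_kernel N x| <= 2 * a.
  rewrite h; apply: le_trans s2a; rewrite ler_piMr // ?cos_max //.
have : `|sine_kernel N x| <= a / (sin (y + a) * sin (y - a)).
  by rewrite ler_pdivlMr //; lra.
by move/le_trans; apply; rewrite ler_wpM2l // ltW.
Qed.

Lemma sine_kernelN {R : realType} (N : nat) (x : R) :
  sine_kernel N (- x) = sine_kernel N x.
Proof. by apply: eq_bigr => k _; rewrite mulrN cosN. Qed.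

(** A point in cell [m >= 1] contributes at most [A / (4 m^2 - 1) + 2 a]. Over both sides the first
    parts sum to at most [A], the second to at most [2 (2 a) / (2 q) = pi / (N q)]. *)
Lemma sum_sine_kernel_le {R : realType} (N s : nat) (w : 'I_s -> R) (q : R)
    (j : 'I_s) :
  2 * pi <= N%:R :> R -> 0 < q -> 1 <= N%:R * q ->
  (forall l l' : 'I_s, l != l' -> q <= torus_dist (w l) (w l')) ->
  \sum_(l | l != j) `|sine_kernel N (w j - w l)|
    <= 2 / (pi * N%:R * q ^+ 2) + pi / (N%:R * q).
Proof.
move=> pN q0 Nq sep; pose a : R := pi / (2 * N%:R).
have p0 := @pi_gt0 R; have n0 : 0 < N%:R :> R by lra.
have a0 : 0 < a by rewrite divr_gt0 ?mulr_gt0.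
pose A : R := 2 / (pi * N%:R * q ^+ 2).
have A0 : 0 < A by rewrite divr_gt0 ?mulr_gt0 ?exprn_gt0.
(* Index [m] stands for the cell [m + 1], as in [sum_separated_le]. *)
pose b (m : nat) : R := A * (4 * m.+1%:R ^+ 2 - 1)^-1 + 2 * a.
have W0 (m : nat) : 0 < 4 * m.+1%:R ^+ 2 - 1 :> R.
  have : 1 <= m.+1%:R :> R by rewrite ler1n.
  by move: (m.+1%:R) => z; nra.
have b0 m : 0 <= b m.
  by apply: addr_ge0; apply: mulr_ge0; rewrite ?invr_ge0; exact: ltW.
have kb l : l != j -> `|sine_kernel N (w j - w l)| <=
    b (Num.truncn (torus_dist (w l) (w j) / q)).-1.
  move=> lj; have d2 := torus_dist_le_half (w l) (w j).
  have qd := sep _ _ lj; have [n dE _] := torus_distP (w l) (w j).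
  set D := torus_dist _ _ in d2 qd dE *.
  have D0 : 0 <= D by rewrite dE.
  have t1 : (0 < Num.truncn (D / q))%N by rewrite truncn_gt0 ler_pdivlMr // mul1r.
  rewrite -opprB sine_kernelN.
  have [|||_ ] := @sine_kernel_le R N (w l - w j) (w l + n%:~R - w j) (- n) pN.
  - by rewrite -dE.
  - by rewrite -dE; apply: le_trans Nq _; rewrite ler_wpM2l // ltW.
  - by rewrite mulrNz; ring.
  rewrite -/a -dE => /le_trans; apply; rewrite /b prednK // mulrDr lerD //; last lra.
  have /andP[mD _] : (Num.truncn (D / q))%:R <= D / q < (Num.truncn (D / q)).+1%:R.
    by apply: truncn_itv; apply: divr_ge0 => //; exact: ltW.
  have := W0 (Num.truncn (D / q)).-1; rewrite prednK //.
  rewrite ler_pdivlMr // in mD.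
  have : 1 <= (Num.truncn (D / q))%:R :> R by rewrite ler1n.
  move: ((Num.truncn (D / q))%:R) mD => m mD m1 W1.
  have NmD : (N%:R * q) * m <= N%:R * D by nra.
  have VE : (pi * D) ^+ 2 - a ^+ 2 = a ^+ 2 * (4 * (N%:R * D) ^+ 2 - 1).
    by rewrite /a; field; rewrite gt_eqF.
  have AE : A * a = (N%:R * q) ^- 2.
    by rewrite /A /a; move: (@pi R) p0 => P P0; field; rewrite !gt_eqF.
  (* [N q >= 1] allows the factor [(N q)^2] to be pulled out of [4 (N q m)^2 - 1]. *)
  have NW : (N%:R * q) ^+ 2 * (4 * m ^+ 2 - 1) <= 4 * (N%:R * D) ^+ 2 - 1.
    have : ((N%:R * q) * m) ^+ 2 <= (N%:R * D) ^+ 2.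
      by rewrite ler_sqr ?nnegrE //; nra.
    by rewrite exprMn; nra.
  have Nq2 : 0 < (N%:R * q) ^+ 2 by rewrite exprn_gt0 // (lt_le_trans ltr01 Nq).
  have V0 : 0 < 4 * (N%:R * D) ^+ 2 - 1.
    by apply: lt_le_trans NW; rewrite mulr_gt0.
  have NqW0 : 0 < (N%:R * q) ^+ 2 * (4 * m ^+ 2 - 1) by exact: mulr_gt0.
  have -> : A = (N%:R * q) ^- 2 / a by rewrite -AE mulfK // gt_eqF.
  have V1 := mulr_gt0 (exprn_gt0 2 a0) V0.
  rewrite VE ler_pdivrMr //.
  have -> : (N%:R * q) ^- 2 / a / (4 * m ^+ 2 - 1) *
      (a ^+ 2 * (4 * (N%:R * D) ^+ 2 - 1)) =
      a * ((4 * (N%:R * D) ^+ 2 - 1) / ((N%:R * q) ^+ 2 * (4 * m ^+ 2 - 1))).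
    move: a a0 {AE VE V1 b b0} => x x0; field.
    by rewrite !gt_eqF.
  by rewrite ler_peMr ?(ltW a0) // ler_pdivlMr // mul1r.
apply: le_trans (ler_sum _ kb) _.
apply: le_trans (@sum_separated_le R s w q j b q0 sep b0) _.
rewrite /b big_split /= -mulr_sumr sumr_const card_ord -[_ *+ Num.truncn _]mulr_natr.
have h1 := @sum_inv_4sqrB1_le R (Num.truncn ((2 * q)^-1)).
have h2 : (Num.truncn ((2 * q)^-1))%:R <= (2 * q)^-1.
  by rewrite truncn_le invr_ge0 mulr_ge0 // ltW.
have -> : pi / (N%:R * q) = 2 * (2 * a * (2 * q)^-1).
  by rewrite /a; field; rewrite !gt_eqF.
have h3 : A * (\sum_(m < Num.truncn ((2 * q)^-1)) (4 * m.+1%:R ^+ 2 - 1)^-1)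
   <= A * (1 / 2) by rewrite ler_wpM2l // ltW.
have h4 : 2 * a * (Num.truncn ((2 * q)^-1))%:R <= 2 * a * (2 * q)^-1.
  by rewrite ler_wpM2l // ltW // mulr_gt0.
rewrite -/A; lra.
Qed.

(** * Windowed energy of an exponential sum *)

Lemma expiD {R : realType} (x y : R) : expi (x + y) = expi x * expi y.
Proof.
rewrite /expi cosD sinD; apply/eqP; rewrite eq_complex /= eqxx /=.
by apply/eqP; ring.
Qed.

Lemma normc_expi {R : realType} (x : R) : Normc.normc (expi x) = 1.
Proof. by rewrite /= cos2Dsin2 sqrtr1. Qed.

(** The argument [t] is real and includes the factor [2 pi], so that samples can be centered at
    half-integers too. *)
Definition energy {R : realType} {s : nat} (w : 'I_s -> R) (c : 'I_s -> R[i])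
    (t : R) : R :=
  Normc.normc (\sum_j expi (- (t * w j)) * c j) ^+ 2.

(** Translating the samples only multiplies the coefficients by phases, which preserves their norm
    by [sum_normc_phase]. *)
Lemma energy_shift {R : realType} (s : nat) (w : 'I_s -> R) (c : 'I_s -> R[i])
    (t u : R) :
  energy w c t = energy w (fun j => expi (- (u * w j)) * c j) (t - u).
Proof.
congr (Normc.normc _ ^+ 2); apply: eq_bigr => j _; rewrite mulrA -expiD.
by congr (expi _ * _); ring.
Qed.

Lemma sqr_normc_ReIm {R : realType} (z : R[i]) :
  Normc.normc z ^+ 2 = complex.Re z ^+ 2 + complex.Im z ^+ 2.
Proof. by case: z => x y /=; rewrite sqr_sqrtr // addr_ge0 ?sqr_ge0. Qed.

Lemma energyE {R : realType} (s : nat) (w : 'I_s -> R) (c : 'I_s -> R[i])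
    (t : R) (a := fun j => complex.Re (c j)) (b := fun j => complex.Im (c j)) :
  energy w c t = \sum_j \sum_l
    ((a j * a l + b j * b l) * cos (t * (w j - w l))
     + (b j * a l - a j * b l) * sin (t * (w j - w l))).
Proof.
rewrite /energy sqr_normc_ReIm.
have -> : complex.Re (\sum_j expi (- (t * w j)) * c j) =
    \sum_j (a j * cos (t * w j) + b j * sin (t * w j)).
  rewrite (big_morph _ (@raddfD _ _ (@complex.Re R)) (erefl _)).
  apply: eq_bigr => j _; rewrite /a /b; case: (c j) => x y /=.
  by rewrite cosN sinN; ring.
have -> : complex.Im (\sum_j expi (- (t * w j)) * c j) =
    \sum_j (b j * cos (t * w j) - a j * sin (t * w j)).
  rewrite (big_morph _ (@raddfD _ _ (@complex.Im R)) (erefl _)).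
  apply: eq_bigr => j _; rewrite /a /b; case: (c j) => x y /=.
  by rewrite cosN sinN; ring.
rewrite !expr2 !big_distrlr -big_split; apply: eq_bigr => j _ /=.
rewrite -big_split; apply: eq_bigr => l _ /=.
rewrite (mulrBr t) cosB sinB; ring.
Qed.

(** Windowing kills the sine part of [energyE]. The cosine part is the kernel form applied
    separately to the real and imaginary parts of [c], to which [schur_test] applies. *)
Lemma window_energy {R : realType} (N s : nat) (w : 'I_s -> R) (q : R)
    (c : 'I_s -> R[i]) :
  2 * pi <= N%:R :> R -> 0 < q -> 1 <= N%:R * q ->
  (forall l l' : 'I_s, l != l' -> q <= torus_dist (w l) (w l')) ->
  `|\sum_(k < N) sin (pi / N%:R * k%:R) * energy w c (2 * pi * (k%:R - N%:R / 2))
    - 2 * N%:R / pi * \sum_j Normc.normc (c j) ^+ 2|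
  <= (2 / (pi * N%:R * q ^+ 2) + pi / (N%:R * q) + pi / (4 * N%:R))
     * \sum_j Normc.normc (c j) ^+ 2.
Proof.
move=> pN q0 Nq sep.
have p0 := @pi_gt0 R; have n0 : 0 < N%:R :> R by lra.
have N0 : (0 < N)%N by rewrite ltr0n in n0.
pose a j := complex.Re (c j); pose b j := complex.Im (c j).
pose K j l := sine_kernel N (w j - w l).
pose Q (x : 'I_s -> R) := \sum_j \sum_l x j * x l * K j l.
have sK j l : \sum_(k < N) sin (pi / N%:R * k%:R)
    * sin (2 * pi * (k%:R - N%:R / 2) * (w j - w l)) = 0.
  have [->|jl] := eqVneq j l.
    by rewrite big1 // => k _; rewrite subrr mulr0 sin0 mulr0.
  apply: sine_window_sin_eq0 => //.
  have [n dE _] := torus_distP (w j) (w l); have qd := sep _ _ jl.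
  have [|||//] := @sine_kernel_le R N (w j - w l) (w j + n%:~R - w l) (- n) pN.
  - by rewrite -dE torus_dist_le_half.
  - by rewrite -dE; apply: le_trans Nq _; rewrite ler_wpM2l // ltW.
  - by rewrite mulrNz; ring.
have -> : \sum_(k < N) sin (pi / N%:R * k%:R)
    * energy w c (2 * pi * (k%:R - N%:R / 2)) = Q a + Q b.
  under eq_bigr => k _ do rewrite energyE mulr_sumr.
  rewrite exchange_big -big_split; apply: eq_bigr => j _ /=.
  under eq_bigr => k _ do rewrite mulr_sumr.
  rewrite exchange_big -big_split; apply: eq_bigr => l _ /=.
  (* A zero multiple of [sK j l] is added to match the sine part. *)
  rewrite -mulrDl -[RHS]addr0 -[X in _ = _ + X](mulr0 (b j * a l - a j * b l)).
  rewrite -[X in _ = _ + _ * X](sK j l) /K /sine_kernel !mulr_sumr -big_split.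
  apply: eq_bigr => k _ /=.
  rewrite -/(a j) -/(a l) -/(b j) -/(b l); ring.
have -> : \sum_j Normc.normc (c j) ^+ 2 = \sum_j a j ^+ 2 + \sum_j b j ^+ 2.
  by rewrite -big_split; apply: eq_bigr => j _; exact: sqr_normc_ReIm.
have Kjj j : K j j = sine_kernel N 0 by rewrite /K subrr.
have Ksym j l : K j l = K l j by rewrite /K -opprB sine_kernelN.
have KS j := @sum_sine_kernel_le R N s w q j pN q0 Nq sep.
have := schur_test s K _ _ a Kjj Ksym KS.
have := schur_test s K _ _ b Kjj Ksym KS.
have := @sine_kernel0 R N pN.
rewrite -/(Q a) -/(Q b).
have : 0 <= \sum_j a j ^+ 2 by apply: sumr_ge0 => j _; exact: sqr_ge0.
have : 0 <= \sum_j b j ^+ 2 by apply: sumr_ge0 => j _; exact: sqr_ge0.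
have -> : pi / (2 * N%:R) / 2 = pi / (4 * N%:R) :> R.
  by field; rewrite gt_eqF.
move: (sine_kernel N 0) (2 * N%:R / pi) (\sum_j a j ^+ 2) (\sum_j b j ^+ 2).
move: (2 / (pi * N%:R * q ^+ 2) + pi / (N%:R * q)) (pi / (4 * N%:R)) (Q a) (Q b).
move=> S e Qa Qb D D' x y y0 x0.
rewrite !ler_norml => /andP[? ?] /andP[? ?] /andP[? ?]; apply/andP.
by split; nra.
Qed.

Lemma energy_ge0 {R : realType} (s : nat) (w : 'I_s -> R) (c : 'I_s -> R[i]) (t : R) :
  0 <= energy w c t.
Proof. exact: sqr_ge0. Qed.

Lemma sqr_l2norm {R : realType} (n : nat) (v : 'cV[R[i]]_n) :
  l2norm v ^+ 2 = \sum_i Normc.normc (v i 0) ^+ 2.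
Proof. by rewrite sqr_sqrtr // sumr_ge0 // => i _; exact: sqr_ge0. Qed.

Lemma sqr_l2norm_vandermonde {R : realType} (L s : nat) (w : 'I_s -> R)
    (c : 'cV[R[i]]_s) :
  l2norm (vandermonde L w *m c) ^+ 2 =
  \sum_(k < L.+1) energy w (fun j => c j 0) (2 * pi * k%:R).
Proof.
rewrite sqr_l2norm; apply: eq_bigr => k _; rewrite mxE /energy.
by congr (Normc.normc _ ^+ 2); apply: eq_bigr => j _; rewrite mxE.
Qed.

Lemma sum_normc_phase {R : realType} (s : nat) (f : 'I_s -> R)
    (c : 'I_s -> R[i]) :
  \sum_j Normc.normc (expi (f j) * c j) ^+ 2 = \sum_j Normc.normc (c j) ^+ 2.
Proof. by apply: eq_bigr => j _; rewrite Normc.normcM normc_expi mul1r. Qed.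

(** [2 sin(x)^2 = 1 - cos (2 x)], and the cosine is nonpositive on this range. *)
Lemma sqrt2_sin_ge1 {R : realType} (x : R) :
  pi / 4 <= x -> x <= 3 * pi / 4 -> 1 <= Num.sqrt 2 * sin x.
Proof.
move=> x1 x2; have p0 := @pi_gt0 R.
have s0 : 0 <= sin x by apply: sin_ge0_pi; lra.
have c0 : cos (2 * x) <= 0.
  rewrite -oppr_ge0 -sinBpihalf; apply: sin_ge0_pi; lra.
have r0 := @sqrtr_ge0 R 2; have r2 := @sqr_sqrtr R 2 (ler0n _ _).
rewrite -(@ler_sqr R) ?nnegrE ?mulr_ge0 // exprMn r2 expr1n.
move: c0; rewrite cos_sin_half (_ : 2 * x / 2 = x); first by lra.
by field.
Qed.

(** * The lower and upper frame bounds *)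

Lemma energy_sum_ge {R : realType} (L s : nat) (w : 'I_s -> R) (q : R)
    (c : 'I_s -> R[i]) :
  2 * pi <= L%:R :> R -> 0 < q -> 1 <= L%:R * q ->
  (forall l l' : 'I_s, l != l' -> q <= torus_dist (w l) (w l')) ->
  (2 / pi - 2 / (pi * L%:R ^+ 2 * q ^+ 2) - 4 / L%:R)
    * \sum_j Normc.normc (c j) ^+ 2
  <= L%:R^-1 * \sum_(k < L.+1) energy w c (2 * pi * k%:R).
Proof.
move=> pL q0 Lq sep; have p0 := @pi_gt0 R; have n0 : 0 < L%:R :> R by lra.
have p3 := @pi_le_3dot2 R.
pose b j := expi (- (2 * pi * (L%:R / 2) * w j)) * c j.
have := @window_energy R L s w q b pL q0 Lq sep; rewrite sum_normc_phase.
set X := \sum_j Normc.normc (c j) ^+ 2; set Y := \sum_(k < L) _.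
rewrite ler_norml => /andP[h _].
have X0 : 0 <= X by apply: sumr_ge0 => j _; exact: sqr_ge0.
have YE : Y <= \sum_(k < L.+1) energy w c (2 * pi * k%:R).
  (* The window covers [k < L]; the last sample [k = L] is dropped. *)
  rewrite big_ord_recr /= -[Y]addr0 lerD ?energy_ge0 //; apply: ler_sum => k _.
  rewrite [X in _ <= X](@energy_shift R s w c _ (2 * pi * (L%:R / 2))) -mulrBr.
  by rewrite ler_piMl ?energy_ge0 // sin_le1.
have Lq1 : pi / (L%:R * q) <= pi by rewrite ler_pdivrMr ?mulr_gt0 // ler_peMr // ltW.
have L4 : pi / (4 * L%:R) <= 1 / 8 :> R by rewrite ler_pdivrMr ?mulr_gt0 //; lra.
rewrite ler_pdivlMl // mulrA; apply: le_trans YE.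
have -> : L%:R * (2 / pi - 2 / (pi * L%:R ^+ 2 * q ^+ 2) - 4 / L%:R) =
   2 * L%:R / pi - 2 / (pi * L%:R * q ^+ 2) - 4.
  by move: (@pi R) p0 => P P0; field; rewrite !gt_eqF.
(* The error terms are at most [16/5 + 1/8 < 4], whence the constant in [4 / L]. *)
have : (pi / (L%:R * q) + pi / (4 * L%:R)) * X <= 4 * X.
  by rewrite ler_wpM2r //; lra.
by lra.
Qed.

Lemma energy_sum_le {R : realType} (K s : nat) (w : 'I_s -> R) (q : R)
    (c : 'I_s -> R[i]) :
  ~~ odd K -> pi <= K%:R :> R -> 0 < q -> 1 <= K%:R * q ->
  (forall l l' : 'I_s, l != l' -> q <= torus_dist (w l) (w l')) ->
  K%:R^-1 * \sum_(k < K.+1) energy w c (2 * pi * k%:R) <=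
  (4 * Num.sqrt 2 / pi + Num.sqrt 2 / (pi * K%:R ^+ 2 * q ^+ 2)
     + 3 * Num.sqrt 2 / K%:R) * \sum_j Normc.normc (c j) ^+ 2.
Proof.
move=> Keven pK q0 Kq sep; have p0 := @pi_gt0 R; have n0 : 0 < K%:R :> R by lra.
have p3 := @pi_le_3dot2 R.
have [h hK] : exists h, K = h.*2 by exists K./2; rewrite even_halfK.
have h0 : (0 < h)%N by move: n0; rewrite ltr0n hK double_gt0.
have KE : K%:R = 2 * h%:R :> R by rewrite hK -muln2 natrM mulrC.
have NE : K.*2%:R = 2 * K%:R :> R by rewrite -muln2 natrM mulrC.
(* This phase puts sample [k] at window index [k + h]. With [K = 2 h] the window angle runs from
   [pi / 4] at [k = 0] to [3 pi / 4] at [k = K]. *)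
pose b j := expi (- (2 * pi * h%:R * w j)) * c j.
have pN : 2 * pi <= K.*2%:R :> R by rewrite NE; lra.
have Nq : 1 <= K.*2%:R * q by rewrite NE; lra.
have := @window_energy R K.*2 s w q b pN q0 Nq sep; rewrite NE sum_normc_phase.
set X := \sum_j Normc.normc (c j) ^+ 2; set Y := \sum_(k < K.*2) _.
rewrite ler_norml => /andP[_ W].
have X0 : 0 <= X by apply: sumr_ge0 => j _; exact: sqr_ge0.
have r0 := @sqrtr_ge0 R 2.
have h0R : 0 < h%:R :> R by rewrite ltr0n.
have YE : \sum_(k < K.+1) energy w c (2 * pi * k%:R) <= Num.sqrt 2 * Y.
  pose F (k : nat) : R := sin (pi / (2 * K%:R) * k%:R) *
    energy w b (2 * pi * (k%:R - 2 * K%:R / 2)).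
  have F0 (k : nat) : (k < K.*2)%N -> 0 <= F k.
    move=> kN; rewrite mulr_ge0 ?energy_ge0 //; apply: sin_ge0_pi.
    rewrite mulrAC; apply/andP; split; first by rewrite divr_ge0 ?mulr_ge0 // ltW.
    by rewrite ler_pdivrMr ?mulr_gt0 // ler_wpM2l ?ltW // -NE ltr_nat.
  have -> : Y = \sum_(0 <= k < K.*2) F k by rewrite big_mkord.
  have hK2 : (h <= K.*2)%N by rewrite hK -!addnn -addnA leq_addr.
  have Kh : (K.+1 + h <= K.*2)%N.
    by rewrite -addnn addSn -addnS leq_add2l hK -addnn -addn1 leq_add2l.
  rewrite (@big_cat_nat _ _ _ h) //= (@big_cat_nat _ _ _ (K.+1 + h) h) ?leq_addl //=.
  (* The window terms outside [h <= k <= K + h] are nonnegative and are dropped. *)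
  apply: (@le_trans _ _ (Num.sqrt 2 * \sum_(h <= k < K.+1 + h) F k)); last first.
    rewrite ler_wpM2l // addrCA lerDl addr_ge0 // big_seq_cond sumr_ge0 // => k.
      by rewrite mem_index_iota andbT => /andP[_ kh]; exact/F0/(leq_trans kh).
    by rewrite mem_index_iota andbT => /andP[_ kh]; apply: F0.
  rewrite -{1}[h]add0n big_addn addnK big_mkord mulr_sumr; apply: ler_sum => k _.
  rewrite [X in X <= _](@energy_shift R s w c _ (2 * pi * h%:R)) /F.
  have -> : 2 * pi * ((k + h)%:R - 2 * K%:R / 2) = 2 * pi * k%:R - 2 * pi * h%:R :> R.
    by rewrite KE natrD; field.
  rewrite mulrA ler_peMl ?energy_ge0 //; apply: sqrt2_sin_ge1.
    rewrite mulrAC ler_pdivlMr ?mulr_gt0 // natrD KE.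
    by have := ler0n R k; nra.
  rewrite mulrAC ler_pdivrMr ?mulr_gt0 // natrD KE.
  have : k%:R <= K%:R :> R by rewrite ler_nat -ltnS.
  by rewrite KE; nra.
have Kq1 : pi / (2 * K%:R * q) <= pi / 2.
  by rewrite ler_pdivrMr ?mulr_gt0 //; nra.
have K4 : pi / (4 * (2 * K%:R)) <= 1 / 8 :> R.
  by rewrite ler_pdivrMr ?mulr_gt0 //; lra.
rewrite ler_pdivrMl // mulrA; apply: le_trans YE _.
have -> : K%:R * (4 * Num.sqrt 2 / pi + Num.sqrt 2 / (pi * K%:R ^+ 2 * q ^+ 2)
     + 3 * Num.sqrt 2 / K%:R) =
   Num.sqrt 2 * (2 * (2 * K%:R) / pi + 2 / (pi * (2 * K%:R) * q ^+ 2) + 3).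
  by move: (@pi R) p0 => P P0; field; rewrite !gt_eqF.
rewrite -[X in _ <= X]mulrA ler_wpM2l //.
(* The error terms are at most [8/5 + 1/8 < 3]. *)
have : (pi / (2 * K%:R * q) + pi / (4 * (2 * K%:R))) * X <= 3 * X.
  by rewrite ler_wpM2r //; lra.
by lra.
Qed.

(** * Passage to singular values and conclusion *)

Lemma singular_value_norm {R : realType} (m n : nat) (A : 'M[R[i]]_(m, n)) (x : R) :
  singular_values A x ->
  exists2 c : 'cV[R[i]]_n, 0 < l2norm c ^+ 2 &
    l2norm (A *m c) ^+ 2 = x ^+ 2 * l2norm c ^+ 2.
Proof.
case=> x0 /eigenvalueP[v vA v0].
have sqE k (u : 'rV[R[i]]_k) :
    (l2norm (u^t*%sesqui) ^+ 2)%:C%C = (u *m u^t*%sesqui) 0 0.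
  rewrite sqr_l2norm rmorph_sum /= mxE; apply: eq_bigr => i _; rewrite !mxE.
  case: (u 0 i) => a b /=; rewrite sqr_sqrtr ?addr_ge0 ?sqr_ge0 //.
  by apply/eqP; rewrite eq_complex /=; apply/andP; split; apply/eqP; ring.
(* [eigenvalue] provides a row vector [v]; its adjoint is the required column vector, since
   [|A v^*|^2 = v A^* A v^*]. *)
exists (v^t*%sesqui).
  rewrite lt0r sqr_ge0 andbT; apply: contraNneq v0 => e.
  move: e; rewrite sqr_l2norm => /eqP;
    rewrite psumr_eq0 => [/allP h|i _]; last exact: sqr_ge0.
  apply/eqP/rowP => i; have := h i (mem_index_enum _); rewrite /= !mxE sqrf_eq0.
  by move/eqP/Normc.eq0_normc/eqP; rewrite conjC_eq0 => /eqP.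
have AvE : A *m v^t*%sesqui = (v *m A^t*%sesqui)^t*%sesqui.
  by rewrite trmx_mul map_mxM /= trmxCK.
apply: complexI; rewrite AvE sqE rmorphM /= sqE -AvE mulmxA -(mulmxA v) vA.
by rewrite -scalemxAl mxE.
Qed.

Lemma vandermonde_neq0 {R : realType} (L s : nat) (w : 'I_s -> R) :
  (0 < s)%N -> vandermonde L w != 0.
Proof.
move=> s0; apply/negP => /eqP/matrixP/(_ 0 (Ordinal s0)); rewrite !mxE.
by rewrite mulr0 mul0r oppr0 /expi cos0 => -[/eqP]; rewrite oner_eq0.
Qed.

Theorem theorem2 (R : realType) (L s : nat) (w : 'I_s -> R)
    (hL : (0 < L)%N) (hs : (2 <= s)%N)
    (hw : forall j : 'I_s, 0 <= w j < 1) (hinj : injective w)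
    (hpos : 0 < 2 / pi - 4 / L%:R :> R)
    (hgap : L%:R^-1 * Num.sqrt (2 / pi) * (Num.sqrt (2 / pi - 4 / L%:R))^-1
            < min_gap w) :
  let q := min_gap w in
  let Phi := vandermonde L w in
  (~~ odd L ->
    (forall c : 'cV[R[i]]_s,
      (2 / pi - 2 / (pi * L%:R ^+ 2 * q ^+ 2) - 4 / L%:R) * l2norm c ^+ 2
        <= L%:R^-1 * l2norm (Phi *m c) ^+ 2
      /\ L%:R^-1 * l2norm (Phi *m c) ^+ 2
        <= (4 * Num.sqrt 2 / pi + Num.sqrt 2 / (pi * L%:R ^+ 2 * q ^+ 2)
            + 3 * Num.sqrt 2 / L%:R) * l2norm c ^+ 2)
    /\ L%:R^-1 * sigma_max Phi ^+ 2
        <= 4 * Num.sqrt 2 / pi + Num.sqrt 2 / (pi * L%:R ^+ 2 * q ^+ 2)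
           + 3 * Num.sqrt 2 / L%:R
    /\ 2 / pi - 2 / (pi * L%:R ^+ 2 * q ^+ 2) - 4 / L%:R
        <= L%:R^-1 * sigma_min Phi ^+ 2)
  /\
  (odd L ->
    forall c : 'cV[R[i]]_s,
      (2 / pi - 2 / (pi * L%:R ^+ 2 * q ^+ 2) - 4 / L%:R) * l2norm c ^+ 2
        <= L%:R^-1 * l2norm (Phi *m c) ^+ 2
      /\ L%:R^-1 * l2norm (Phi *m c) ^+ 2
        <= (1 + L%:R^-1)
           * (4 * Num.sqrt 2 / pi
              + Num.sqrt 2 / (pi * L.+1%:R ^+ 2 * q ^+ 2)
              + 3 * Num.sqrt 2 / L.+1%:R) * l2norm c ^+ 2).
Proof.
move=> q Phi.
have p0 := @pi_gt0 R.
have n0 : 0 < L%:R :> R by rewrite ltr0n.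
(* [2 / pi > 4 / L] means [L > 2 pi]. *)
have pL : 2 * pi <= L%:R :> R.
  move: hpos; rewrite subr_gt0 ltr_pdivrMr // mulrAC ltr_pdivlMr //; lra.
(* The quotient of the two square roots in the gap condition is at least 1. *)
have Lq : 1 < L%:R * q.
  rewrite -ltr_pdivrMl // mulr1; apply: le_lt_trans hgap.
  rewrite -mulrA ler_peMr ?invr_gt0 // ler_pdivlMr ?sqrtr_gt0 // mul1r.
  by apply: ler_wsqrtr; rewrite gerBl divr_ge0 // ltW.
have q0 : 0 < q by rewrite -(pmulr_rgt0 _ n0) (lt_trans ltr01).
have sep : forall l l' : 'I_s, l != l' -> q <= torus_dist (w l) (w l').
  exact: (min_gapP w hs).2.
have lower (c : 'cV[R[i]]_s) :
    (2 / pi - 2 / (pi * L%:R ^+ 2 * q ^+ 2) - 4 / L%:R) * l2norm c ^+ 2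
      <= L%:R^-1 * l2norm (Phi *m c) ^+ 2.
  rewrite sqr_l2norm_vandermonde sqr_l2norm.
  exact: (@energy_sum_ge R L s w q (fun j => c j 0) pL q0 (ltW Lq) sep).
split=> [Leven|Lodd]; last first.
  move=> c; split; first exact: lower.
  have pK : pi <= L.+1%:R :> R by rewrite -natr1; lra.
  have Kq : 1 <= L.+1%:R * q by rewrite -natr1 mulrDl; lra.
  have Keven : ~~ odd L.+1 by rewrite /= negbK.
  have := @energy_sum_le R L.+1 s w q (fun j => c j 0) Keven pK q0 Kq sep.
  rewrite -sqr_l2norm; set U := (X in _ <= X * _); set S := \sum_(k < L.+2) _ => SU.
  (* Changing the normalization from [L + 1] to [L] costs the factor [1 + 1 / L]; the extra sample
     at [L + 1] only increases the sum. *)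
  have LE : L%:R^-1 = (1 + L%:R^-1) * L.+1%:R^-1 :> R.
    by rewrite -natr1; field; rewrite !gt_eqF // addr_gt0.
  rewrite -/U -mulrA {1}LE -mulrA ler_wpM2l ?addr_ge0 ?invr_ge0 ?(ltW n0) //.
  apply: le_trans SU; rewrite ler_wpM2l ?invr_ge0 // sqr_l2norm_vandermonde.
  by rewrite /S [X in _ <= X]big_ord_recr /= lerDl energy_ge0.
have upper (c : 'cV[R[i]]_s) : L%:R^-1 * l2norm (Phi *m c) ^+ 2
    <= (4 * Num.sqrt 2 / pi + Num.sqrt 2 / (pi * L%:R ^+ 2 * q ^+ 2)
        + 3 * Num.sqrt 2 / L%:R) * l2norm c ^+ 2.
  have pL' : pi <= L%:R :> R by lra.
  rewrite sqr_l2norm_vandermonde sqr_l2norm.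
  exact: (@energy_sum_le R L s w q (fun j => c j 0) Leven pL' q0 (ltW Lq) sep).
have Phi0 : Phi != 0 by apply: vandermonde_neq0; exact: ltnW hs.
split; first by move=> c; split.
split.
  (* The extremal singular value is attained, so the frame bound is applied to its vector [c] and
     divided by the norm squared. *)
  have [[/singular_value_norm[c c0 cE] _] _] := sigma_maxP Phi0.
  by have := upper c; rewrite cE (mulrA L%:R^-1) ler_pM2r.
have [[/singular_value_norm[c c0 cE] _] _] := sigma_minP Phi0.
by have := lower c; rewrite cE (mulrA L%:R^-1) ler_pM2r.
Qed.
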